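(* Let $X$ be a Banach space, $\bar{x} \in X$, $F : X \to X$ a $C^1$ map, and $A : X \to X$ an injective linear map. Fix $R \in [0, \infty]$, and let $Y, Z = Z(R) \ge 0$ be two constants satisfying $$\|A F(\bar{x})\|_X \le Y, \qquad \sup_{x \in B(\bar{x}, R)} \|I - A\, DF(x)\|_{\mathscr{B}(X)} \le Z.$$ If $Z < 1$, then, for any real $r \ge 0$ such that $$\frac{Y}{1 - Z} \le r \le R,$$ the fixed-point operator $x \mapsto x - A F(x)$ is a contraction on $B(\bar{x}, r)$ (it maps $B(\bar{x},r)$ into itself and is Lipschitz there with a constant strictly less than $1$), so that there exists a unique zero $x^\star \in B(\bar{x}, r)$ of $F$.
   Context: $\mathscr{B}(X)$ denotes the space of bounded linear operators from $X$ to itself with the operator norm. $B(\bar{x}, r)$ denotes the closed ball in $X$ centered at $\bar{x}$ with radius $r$; by convention, $B(\bar{x}, \infty) = X$. $DF$ denotes the Fréchet derivative of $F$ and $I$ the identity on $X$. The hypothesis on $Z$ includes that $I - A\,DF(x) \in \mathscr{B}(X)$ for every $x \in B(\bar{x}, R)$. *)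

(* Defs.v *)
From HB Require Import structures.
From mathcomp Require Import all_boot all_order all_algebra.
From mathcomp Require Import all_classical all_reals all_analysis.

Set Implicit Arguments.
Unset Strict Implicit.
Unset Printing Implicit Defensive.

Import Order.TTheory GRing.Theory Num.Theory.
Import numFieldNormedType.Exports.

Local Open Scope classical_set_scope.
Local Open Scope ring_scope.

(* The library's [closed_ball x e] is the closure of the open ball, hence empty
   for e = 0, and only accepts finite radii; here the ball of radius 0 is the
   singleton of its center and the ball of radius +oo is the whole space. *)
Definition cball (R : realType) (X : normedModType R) (x : X) (rho : \bar R) :
    set X :=
  [set y | (`|x - y|%:E <= rho)%E].

Definition bounded_operator (R : realType) (X : normedModType R)
    (L : X -> X) : Prop :=
  linear L /\ bounded_fun_norm L.

(* Meaningful on linear maps only; +oo when the linear map is unbounded. *)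
Definition opnorm (R : realType) (X : normedModType R) (L : X -> X) : \bar R :=
  ereal_sup [set `|L u|%:E | u in [set u : X | `|u| <= 1]].

(* [differentiable] is Frechet differentiability and includes the continuity of
   the linear map ['d F x]; the second clause is the continuity of x |-> 'd F x
   for the operator norm. *)
Definition C1_map (R : realType) (X : normedModType R) (F : X -> X) : Prop :=
  (forall x : X, differentiable F x) /\
  (forall x : X,
     opnorm (fun u => 'd F y u - 'd F x u) @[y --> x] --> (0%E : \bar R)).

(* Main.v *)
(* As A is not assumed bounded, it is not clear a priori that x - A (F x) is
   differentiable. But A \o DF(xbar) lies at distance Z < 1 from the identity, so
   it is onto, hence so is DF(xbar) because A is injective; the open mapping
   theorem for DF(xbar) then shows that A is bounded. The mean value inequality
   makes x - A (F x) Z-Lipschitz on the ball, the bound Y + Z r <= r makes it a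
   self-map, and injectivity of A identifies its fixed points with zeros of F. *)
Require Import Defs.
From HB Require Import structures.
From mathcomp Require Import all_boot all_order all_algebra.
From mathcomp Require Import all_classical all_reals all_analysis ring lra.

Set Implicit Arguments.
Unset Strict Implicit.
Unset Printing Implicit Defensive.

Import Order.TTheory GRing.Theory Num.Theory.
Import numFieldNormedType.Exports.

Local Open Scope classical_set_scope.
Local Open Scope ring_scope.

(** Continuous induction along the segment: differentiability gives a local estimate around each
    parameter with a slightly larger slope, and these estimates are chained from 0 to 1. Letting the
    excess tend to 0 gives the bound. *)
Lemma mean_value_ineq (R : realType) (V W : normedModType R) (f : V -> W)
    (K : R) (x y : V) :
  (forall t : R, 0 <= t <= 1 -> differentiable f (x + t *: (y - x))) ->
  (forall t : R, 0 <= t <= 1 ->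
     forall u, `|'d f (x + t *: (y - x)) u| <= K * `|u|) ->
  `|f y - f x| <= K * `|y - x|.
Proof.
move=> df dfK; set h := y - x; pose p t := x + t *: h.
apply/ler_addgt0Pr => _/posnumP[e].
have h1 : 0 < `|h| + 1 by rewrite ltr_wpDl.
(* The [+ 1] keeps the divisor positive when [h = 0]; the total excess [e' * |h|] stays below
   [e]. *)
pose e' := e%:num / (`|h| + 1); have e'0 : 0 < e' by rewrite divr_gt0.
have loc (t : R) : 0 <= t <= 1 -> \forall s \near t,
    `|f (p s) - f (p t)| <= (K + e') * `|h| * `|s - t|.
  move=> t01; have := diff_locally (df t t01) => /eqaddoP/(_ _ e'0) E.
  have cp : (fun s : R => (s - t) *: h) @ t --> (0 : V).
    rewrite -[X in _ --> X](scale0r h); apply: cvgZr_tmp.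
    rewrite -[X in _ --> X](subrr t).
    by apply: (@cvgB _ _ _ _ _ id (cst t)); [exact: cvg_id|exact: cvg_cst].
  have := cp _ E; apply: (@filterS _ (nbhs t)) => s /=.
  rewrite !fctE/= -/h addrCA -scalerDl subrK -/(p s) -/(p t) => H.
  rewrite -[X in `|X|](subrK ('d f (p t) ((s - t) *: h))).
  rewrite (le_trans (ler_normD _ _))// mulrDl mulrDl addrC lerD//.
    by rewrite (le_trans (dfK t t01 _))// normrZ mulrCA mulrC.
  rewrite -mulrA [`|h| * _]mulrC -normrZ; apply: le_trans H.
  by rewrite opprD addrA.
(* The supremum of [S] is attained, and [loc] forbids it to be less than 1. *)
pose S := [set t : R | 0 <= t <= 1 /\
  `|f (p t) - f x| <= (K + e') * `|h| * t].
have S0 : S 0.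
  split; first by rewrite lexx ler01.
  by rewrite /p scale0r addr0 subrr normr0 mulr0.
have hS : has_sup S.
  by split; [exists 0|exists 1 => t [/andP[]]].
have s01 : 0 <= sup S <= 1.
  rewrite ub_le_sup//=; last by case: hS.
  by apply: ge_sup; [exists 0|move=> t [/andP[]]].
have [d /= d0 Hd] := (nbhs_ballP _ _).1 (loc _ s01).
(* Bounds over [0, t] and [t, u] add up, so a local estimate carries membership in [S] from [t] to
   [u]. *)
have trS t u : S t -> t <= u -> 0 <= u <= 1 ->
   `|f (p u) - f (p t)| <= (K + e') * `|h| * `|u - t| -> S u.
  move=> [t01 Ht] tu u01 Hu; split=> //.
  rewrite (le_trans (ler_distD (f (p t)) _ _))//.
  by rewrite (le_trans (lerD Hu Ht))// -mulrDr ger0_norm ?subr_ge0// subrK.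
have Ss : S (sup S).
  have [t St dt] := sup_adherent d0 hS.
  have ts : t <= sup S by apply: ub_le_sup => //; case: hS.
  apply: (trS t) => //; rewrite distrC [X in _ * X]distrC; apply: Hd.
  by rewrite /ball/= ger0_norm ?subr_ge0// ltrBlDl -ltrBlDr.
have s1 : sup S = 1.
  apply/eqP; rewrite eq_le; case/andP: (s01) => s0 -> /=; rewrite leNgt.
  apply/negP => s1; pose u := Num.min 1 (sup S + d / 2).
  have su : sup S < u by rewrite lt_min s1 ltrDl divr_gt0.
  have : u <= sup S.
    apply: ub_le_sup; first by case: hS.
    apply: (trS _ _ Ss (ltW su)).
      by rewrite (le_trans s0 (ltW su))/= ge_min lexx.
    apply: Hd; rewrite /ball/= distrC ger0_norm ?subr_ge0 ?(ltW su)//.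
    rewrite ltrBlDl (@le_lt_trans _ _ (sup S + d / 2)) ?ge_min ?lexx ?orbT//.
    by rewrite ltrD2l ltr_pdivrMr// ltr_pMr// ltr1n.
  by rewrite leNgt su.
have [_] : S 1 by rewrite -s1.
rewrite /p scale1r /h [x + _]addrC subrK -/h mulr1 => /le_trans; apply.
rewrite mulrDl lerD2l /e' mulrAC ler_pdivrMr//.
by rewrite ler_wpM2l// lerDl.
Qed.

(* By Baire, the closure of the image of some ball centred at 0 has an interior
   point [x0]; differences of approximations of [x0 + c *: y] and of [x0] then
   approximate [c *: y]. *)
Lemma surjective_almost_open (R : realType) (V : normedModType R)
    (W : completeNormedModType R) (f : {linear V -> W}) :
  (forall y, exists x, f x = y) ->
  exists2 K, 0 <= K & forall y, exists x,
    `|x| <= K * `|y| /\ `|y - f x| <= 2^-1 * `|y|.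
Proof.
move=> fsurj; pose E n := f @` [set x | `|x| <= n%:R].
have [n nd] : exists n, ~ dense (~` closure (E n)).
  apply/existsNP => dE.
  have /Baire : forall n, open (~` closure (E n)) /\ dense (~` closure (E n)).
    by move=> n; split => //; apply: closed_openC; exact: closed_closure.
  move=> /(_ setT); case; [by exists 0|exact: openT|move=> y [_ Ey]].
  have [x fx] := fsurj y.
  apply: (Ey (Num.truncn `|x|).+1 I); apply: subset_closure; exists x => //=.
  by rewrite ltW// truncnS_gt.
have [U [[x0 Ux0] UE]] := (denseNE nd).
have [r /= r0 rU] := (nbhs_ballP _ _).1 (open_nbhs_nbhs Ux0).
have clo y e : `|y| < r -> 0 < e ->
    exists x, `|x| <= n%:R /\ `|x0 + y - f x| < e.
  move=> yr e0.
  have /contrapT cl : ~ ~ closure (E n) (x0 + y).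
    move=> ncl; suff : set0 (x0 + y) by [].
    rewrite -UE; split => //; apply: rU.
    by rewrite -ball_normE/= opprD addNKr normrN.
  have [_ [[x xn <-]]] := cl _ (nbhsx_ballx _ _ e0).
  by rewrite -ball_normE => xe; exists x.
(* Rescaling by [c] gives [y] norm [r / 2]. The difference of two points of the ball of radius [n]
   has norm at most [2 n], and undoing the scaling multiplies it by [2 |y| / r]. Two errors of
   [r / 8] add up to half of [r / 2], whence the factor 1/2. *)
exists (4 * n%:R / r) => [|y]; first by rewrite !mulr_ge0// invr_ge0 ltW.
have [->|y0] := eqVneq y 0.
  by exists 0; rewrite linear0 subrr !normr0 !mulr0.
have yp : 0 < `|y| by rewrite normr_gt0.
pose c := r / 2 / `|y|; have c0 : 0 < c by rewrite !divr_gt0.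
have cy : `|c *: y| < r.
  by rewrite normrZ gtr0_norm// divfK ?gt_eqF// ltr_pdivrMr// ltr_pMr// ltr1n.
have e0 : 0 < r / 8 by rewrite divr_gt0.
have [u [un ue]] := clo _ _ cy e0.
have [v [vn ve]] : exists x, `|x| <= n%:R /\ `|x0 + 0 - f x| < r / 8.
  by apply: clo; rewrite ?normr0.
exists (c^-1 *: (u - v)); split.
  rewrite normrZ normfV gtr0_norm// mulrC ler_pdivrMr//.
  have -> : 4 * n%:R / r * `|y| * c = n%:R + n%:R.
    by rewrite /c; field; rewrite !gt_eqF.
  by rewrite (le_trans (ler_normB _ _))// lerD.
have -> : y - f (c^-1 *: (u - v)) =
    c^-1 *: ((x0 + c *: y - f u) - (x0 + 0 - f v)).
  apply: (scalerI (lt0r_neq0 c0)).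
  have cK z : c *: (c^-1 *: z) = z by rewrite scalerA mulfV ?gt_eqF// scale1r.
  rewrite cK linearZ/= scalerBr cK linearB/= addr0.
  by rewrite !opprB addrCA [RHS]addrC -[x0 + _ - _]addrA [RHS]addrA subrK.
rewrite normrZ normfV gtr0_norm// mulrC ler_pdivrMr//.
have -> : 2^-1 * `|y| * c = r / 8 + r / 8.
  by rewrite /c; field; rewrite !gt_eqF.
by rewrite (le_trans (ler_normB _ _))// lerD// ltW.
Qed.

(** Approximate preimages are taken repeatedly of what remains of [y]. The remainders halve at each
    step, so the corrections form an absolutely convergent series, whose sum is an exact preimage by
    continuity of [f]. *)
Lemma open_mapping (R : realType) (V W : completeNormedModType R)
    (f : {linear V -> W}) :
  continuous f -> (forall y, exists x, f x = y) ->
  exists2 K, 0 <= K & forall y, exists2 x, f x = y & `|x| <= K * `|y|.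
Proof.
move=> fc /surjective_almost_open[K K0 /choice[g gP]].
(* The factor 2 is the sum of the geometric series of ratio 1/2. *)
exists (K * 2) => [|y]; first by rewrite mulr_ge0.
pose r n := iter n (fun z => z - f (g z)) y.
have rn n : `|r n| <= `|y| * 2^-1 ^+ n.
  elim: n => [|n ih]; first by rewrite expr0 mulr1.
  rewrite exprS mulrCA (le_trans (gP _).2)// ler_wpM2l//.
pose u := [sequence g (r n)]_n.
have un n : `|u n| <= geometric (K * `|y|) 2^-1 n.
  by rewrite (le_trans (gP _).1)//= -mulrA ler_wpM2l.
have half1 : `|2^-1 : R| < 1 by rewrite ger0_norm// invf_lt1// ltr1n.
have cn : cvgn [normed series u].
  apply: series_le_cvg un _ => [n|n|]; first exact: normr_ge0.
  - by rewrite geometric_ge0// mulr_ge0.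
  - exact: is_cvg_geometric_series.
have cu := normed_cvg cn.
(* Telescoping: the first [n] corrections account for all of [y] but the remainder [r n]. *)
have fu n : f (series u n) = y - r n.
  elim: n => [|n ih]; first by rewrite /series/= big_geq// linear0 subrr.
  rewrite seriesSr linearD ih/= -addrA; congr (_ + _).
  by rewrite opprB addrC.
have r_0 : r n @[n --> \oo] --> (0 : W).
  apply/cvgr0Pnorm_le => e e0.
  have := cvg_geometric `|y| half1 => /cvgr0Pnorm_le/(_ _ e0).
  apply: filterS => n; apply: le_trans; rewrite (le_trans (rn n))//.
  exact: ler_norm.
exists (limn (series u)).
  have fl : (f \o series u) n @[n --> \oo] --> f (limn (series u)).
    by apply: continuous_cvg => //; exact: fc.
  apply: (cvg_unique (@norm_hausdorff _ _) fl).
  rewrite (_ : f \o series u = cst y - r); last exact/funext.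
  by have := cvgB (cvg_cst y) r_0; rewrite subr0; apply.
rewrite -lim_norm//; apply: limr_le; first exact: is_cvg_norm.
apply: nearW => n.
rewrite (le_trans (ler_norm_sum _ _ _))//.
rewrite (@le_trans _ _ (series (geometric (K * `|y|) 2^-1) n))//.
  by rewrite /series/=; apply: ler_sum => i _; exact: un.
have h2 : 0 < (2^-1 : R) by rewrite invr_gt0.
have K0y : 0 <= K * `|y| by rewrite mulr_ge0.
rewrite (le_trans (geometric_le_lim n K0y h2 half1))//.
by rewrite (_ : (1 - 2^-1)^-1 = 2 :> R) 1?mulrAC//; field.
Qed.

Lemma opnorm_le (R : realType) (V : normedModType R) (L : {linear V -> V})
    (K : R) (u : V) :
  (opnorm L <= K%:E)%E -> `|L u| <= K * `|u|.
Proof.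
move=> LK; have [->|u0] := eqVneq u 0; first by rewrite linear0 !normr0 mulr0.
have up : 0 < `|u| by rewrite normr_gt0.
suff : `|L (`|u|^-1 *: u)| <= K.
  by rewrite linearZ/= normrZ normfV normr_id mulrC ler_pdivrMr.
rewrite -lee_fin; apply: le_trans LK; apply: ereal_sup_ubound.
exists (`|u|^-1 *: u) => //=.
by rewrite normrZ normfV normr_id mulVf ?gt_eqF.
Qed.

(** Solutions of [M x = y] are the fixed points of [u |-> y + (u - M u)], which contracts the whole
    space with constant [Z]. *)
Lemma near_id_surjective (R : realType) (X : completeNormedModType R)
    (M : {linear X -> X}) (Z : R) :
  0 <= Z -> Z < 1 -> (forall u, `|u - M u| <= Z * `|u|) ->
  forall y, exists x, M x = y.
Proof.
move=> Z0 Z1 MZ y; pose g (u : X) := y + (u - M u).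
have gT : set_fun setT setT g by [].
pose g' : {fun [set: X] >-> [set: X]} := HB.pack g (isFun.Build _ _ _ _ g gT).
have [||x _ gx] := @banach_fixed_point R X setT g' _ closedT.
- exists (NngNum Z0); split => //= -[a b] _ /=.
  have -> : g a - g b = (a - b) - M (a - b).
    rewrite /g opprD addrACA subrr add0r (linearB M)/= !opprB.
    by rewrite [M b - b]addrC addrACA [- M a + _]addrC.
  exact: MZ.
- by exists 0.
exists x; apply/eqP; rewrite -subr_eq0 -opprB oppr_eq0; apply/eqP.
by apply: (addIr x); rewrite add0r [RHS]gx /= /g addrA addrAC.
Qed.

Lemma near_left_inverse_continuous (R : realType) (X : completeNormedModType R)
    (A B : {linear X -> X}) (Z : R) :
  injective A -> continuous B -> 0 <= Z -> Z < 1 ->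
  (forall u, `|u - A (B u)| <= Z * `|u|) -> continuous A.
Proof.
move=> Ainj Bc Z0 Z1 ABZ.
(* [A \o B] reaches [A y], and the injective [A] cancels. *)
have Bsurj y : exists x, B x = y.
  have [x /Ainj] := near_id_surjective (M := A \o B) Z0 Z1 ABZ (A y).
  by exists x.
have [K K0 BK] := open_mapping Bc Bsurj.
apply: bounded_linear_continuous; apply: (bounded_funP A).1.
move=> r.
(* For [y = B x] with [|x| <= K |y|], the vector [A y = x - (x - A (B x))] has norm at most
   [(1 + Z) |x|]. *)
exists ((1 + Z) * (K * r)) => y yr; have [x Bx xy] := BK y.
rewrite -Bx in xy yr *.
rewrite -[A _](subKr x) (le_trans (ler_normB _ _))//.
rewrite (le_trans (lerD (lexx _) (ABZ _)))// -[X in X + _]mul1r -mulrDl.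
by rewrite ler_wpM2l ?addr_ge0// (le_trans xy)// ler_wpM2l.
Qed.

(** Convexity lets the mean value inequality be applied between any two points of the ball. *)
Lemma cball_segment (R : realType) (X : normedModType R) (c x y : X) (r t : R) :
  cball c r%:E x -> cball c r%:E y -> 0 <= t <= 1 ->
  cball c r%:E (x + t *: (y - x)).
Proof.
rewrite /cball/= !lee_fin => cx cy /andP[t0 t1].
have -> : c - (x + t *: (y - x)) = (1 - t) *: (c - x) + t *: (c - y).
  have -> : y - x = (c - x) - (c - y) by rewrite opprB [RHS]addrC addrA subrK.
  rewrite opprD addrA scalerBl scale1r (scalerBr t) opprB.
  by rewrite [t *: (c - y) + _]addrC addrA.
rewrite (le_trans (ler_normD _ _))// !normrZ !ger0_norm ?subr_ge0//.
rewrite -[leRHS]mul1r -[X in X * r](subrK t) [leRHS]mulrDl.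
by rewrite lerD// ler_wpM2l ?subr_ge0.
Qed.

Lemma cball_closed (R : realType) (X : normedModType R) (c : X) (r : R) :
  closed (cball c r%:E).
Proof.
rewrite (_ : cball c r%:E = closed_ball_ Num.norm c r).
  exact: closed_closed_ball_.
by apply/seteqP; split => y; rewrite /cball/closed_ball_/= lee_fin.
Qed.

Theorem theorem1p1 (R : realType) (X : completeNormedModType R) (xbar : X)
    (F : X -> X) (A : {linear X -> X}) (Rad : \bar R) (Y Z : R)
    (F_C1 : C1_map F)
    (A_inj : injective A)
    (Rad_ge0 : (0 <= Rad)%E)
    (Y_ge0 : 0 <= Y) (Z_ge0 : 0 <= Z)
    (Y_bound : `|A (F xbar)| <= Y)
    (Z_bounded : forall x : X, cball xbar Rad x ->
       bounded_operator (fun u : X => u - A ('d F x u)))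
    (Z_bound : (ereal_sup [set opnorm (fun u : X => (u - A ('d F x u))%R)
                          | x in cball xbar Rad] <= Z%:E)%E)
    (Z_lt1 : Z < 1) (r : R) (r_ge0 : 0 <= r)
    (r_lower : Y / (1 - Z) <= r) (r_upper : (r%:E <= Rad)%E) :
  (exists T : {fun cball xbar r%:E >-> cball xbar r%:E},
     (T : X -> X) = (fun x : X => x - A (F x)) /\ is_contraction T) /\
  (exists! xstar : X, cball xbar r%:E xstar /\ F xstar = 0).
Proof.
have [dF _] := F_C1.
have dZ x u : cball xbar Rad x -> `|u - A ('d F x u)| <= Z * `|u|.
  move=> Rx; apply: (@opnorm_le _ _ (idfun \- (A \o 'd F x))).
  by apply: le_trans Z_bound; apply: ereal_sup_ubound; exists x.
(* The estimate is taken at the center, which lies in the ball because [0 <= Rad]. *)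
have Ac : continuous A.
  apply: (near_left_inverse_continuous A_inj (diff_continuous (dF xbar)) Z_ge0
    Z_lt1).
  by move=> u; apply: dZ; rewrite /cball/= subrr normr0.
pose T x := x - A (F x).
(* Continuity of [A] enters here: it makes [A] its own derivative, so the chain rule applies. *)
have dT x : is_diff x T (idfun \- (A \o 'd F x)).
  have dAF : is_diff x (A \o F) (A \o 'd F x).
    apply: DiffDef.
      by apply: differentiable_comp; [exact: dF|exact: linear_differentiable].
    by rewrite diff_comp ?diff_lin//; exact: linear_differentiable.
  exact: is_diffB.
have Tlip x y : cball xbar r%:E x -> cball xbar r%:E y ->
    `|T x - T y| <= Z * `|x - y|.
  move=> rx ry; apply: mean_value_ineq => t t01.
    exact: (@ex_diff _ _ _ _ _ _ _ (dT _)).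
  move=> u; rewrite (@diff_val _ _ _ _ _ _ _ (dT _)); apply: dZ.
  exact: le_trans (cball_segment ry rx t01) r_upper.
have cb : cball xbar r%:E xbar by rewrite /cball/= subrr normr0.
(* The center moves by [|A (F xbar)| <= Y], so [T x] is within [Y + Z * r] of it; this is at most
   [r] by [r_lower]. *)
have Tr : set_fun (cball xbar r%:E) (cball xbar r%:E) T.
  move=> x rx; rewrite /cball/= lee_fin (le_trans (ler_distD (T xbar) _ _))//.
  rewrite {1}/T subKr (le_trans (lerD Y_bound (Tlip _ _ cb rx)))//.
  have Zr : Z * `|xbar - x| <= Z * r.
    by rewrite ler_wpM2l//; move: rx; rewrite /cball/= lee_fin.
  by move: r_lower; rewrite ler_pdivrMr ?subr_gt0//; lra.
pose T' : {fun cball xbar r%:E >-> cball xbar r%:E} :=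
  HB.pack T (isFun.Build _ _ _ _ T Tr).
have T'c : is_contraction T'.
  by exists (NngNum Z_ge0); split => //= -[x y] [/= rx ry]; exact: Tlip.
have zeroP x : x = T x <-> F x = 0.
  split=> [xT|Fx]; last by rewrite /T Fx linear0 subr0.
  by apply: A_inj; rewrite linear0 -[LHS](subKr x) -/(T x) -xT subrr.
split; first by exists T'.
have [||x rx Tx] := @banach_fixed_point R X _ T' T'c; first exact: cball_closed.
  by exists xbar.
exists x; split; first by split => //; apply/zeroP.
move=> y [ry /zeroP Ty].
exact: (contraction_fixpoint_unique T'c).
Qed.
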